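(* An $\mathcal F$-representation is finitely generated if and only if it has finite length.
   Context: $\mathcal F$ is the category with objects the finite sets $[k]=\{1,\dots,k\}$, $k\ge 0$, and all functions as morphisms. $\mathcal V$ is the category of finite-dimensional $\mathbb Q$-vector spaces. An $\mathcal F$-representation is a functor $V:\mathcal F\to\mathcal V$; these form the abelian category $\mathcal V^{\mathcal F}$, and length refers to this category. For $k\ge0$ let $\otimes^k:\mathcal F\to\mathcal V$ be the functor sending $X$ to the free $\mathbb Q$-vector space on the set of functions $[k]\to X$ (with $\mathcal F$ acting by postcomposition). $V$ is finitely generated if there is a surjection onto $V$ from a finite direct sum of functors $\otimes^{k}$ (various $k$). *)

(* Defs.v *)
From HB Require Import structures.
From mathcomp Require Import all_boot all_order all_algebra.

Set Implicit Arguments.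
Unset Strict Implicit.
Unset Printing Implicit Defensive.

Import GRing.Theory.
Local Open Scope ring_scope.

(* The category F: the object [k] is represented by the natural number k, and *)
(* a morphism [m] -> [n] is a finite function, for which Leibniz equality is  *)
(* extensional equality.                                                      *)
Definition fmor (m n : nat) := {ffun 'I_m -> 'I_n}.
Definition fid (n : nat) : fmor n n := [ffun x => x].
Definition fcomp (m n p : nat) (g : fmor n p) (f : fmor m n) : fmor m p :=
  [ffun x => g (f x)].

Record frep := FRep {
  fobj :> nat -> vectType rat;
  fmap : forall m n, fmor m n -> 'Hom(fobj m, fobj n);
  fmap_id : forall n, fmap (fid n) = \1%VF;
  fmap_comp : forall m n p (g : fmor n p) (f : fmor m n),
    fmap (fcomp g f) = (fmap g \o fmap f)%VF }.
Arguments fmap V {m n} f : rename.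

Record fhom (V W : frep) := FHom {
  fcpt :> forall n, 'Hom(V n, W n);
  fcpt_nat : forall m n (f : fmor m n),
    (fcpt n \o fmap V f = fmap W f \o fcpt m)%VF }.

(* Kernels and cokernels in the functor category are computed objectwise, so  *)
(* epimorphisms are the objectwise surjective transformations and subobjects  *)
(* are the subfunctors.                                                       *)
Definition fsurj (V W : frep) (q : fhom V W) : Prop :=
  forall n, limg (q n) = fullv.

Record fsub (V : frep) := FSub {
  fsub_space :> forall n, {vspace V n};
  fsub_stable : forall m n (f : fmor m n),
    (fmap V f @: fsub_space m <= fsub_space n)%VS }.

Section SubRep.
Variables (V : frep) (W : fsub V).

Definition fsub_map m n (f : fmor m n) :
    'Hom(subvs_of (W m), subvs_of (W n)) :=
  (linfun (vsproj (W n)) \o fmap V f \o linfun (@vsval _ _ (W m)))%VF.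

Lemma fsub_mapE m n (f : fmor m n) (x : subvs_of (W m)) :
  vsval (fsub_map f x) = fmap V f (vsval x).
Proof.
rewrite /fsub_map !comp_lfunE !lfunE /= vsprojK //.
by apply: (subvP (fsub_stable W f)); apply: memv_img; apply: subvsP.
Qed.

Lemma fsub_map_id n : fsub_map (fid n) = \1%VF.
Proof.
by apply/lfunP => x; apply: val_inj; rewrite /= fsub_mapE fmap_id !lfunE.
Qed.

Lemma fsub_map_comp m n p (g : fmor n p) (f : fmor m n) :
  fsub_map (fcomp g f) = (fsub_map g \o fsub_map f)%VF.
Proof.
apply/lfunP => x; apply: val_inj.
by rewrite /= comp_lfunE !fsub_mapE fmap_comp comp_lfunE.
Qed.

Definition fsub_rep : frep := FRep fsub_map_id fsub_map_comp.

End SubRep.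

Definition fsimple (S : frep) : Prop :=
  (exists n, (fullv : {vspace S n}) != 0%VS) /\
  (forall W : fsub S,
     (forall n, W n = 0%VS) \/ (forall n, W n = fullv)).

(* The subquotient W2 / W1 is isomorphic to S.                                *)
Definition fsubquotient (V : frep) (W1 W2 : fsub V) (S : frep) : Prop :=
  (forall n, (W1 n <= W2 n)%VS) /\
  (exists q : fhom (fsub_rep W2) S,
     fsurj q /\
     (forall n (x : subvs_of (W2 n)), q n x = 0 <-> vsval x \in W1 n)).

Definition fcomposition_series (V : frep) (l : nat) (W : nat -> fsub V) : Prop :=
  [/\ forall n, W 0%N n = 0%VS,
      forall n, W l n = fullv &
      forall i, (i < l)%N ->
        exists S : frep, fsimple S /\ fsubquotient (W i) (W i.+1) S].

Definition finite_length (V : frep) : Prop :=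
  exists (l : nat) (W : nat -> fsub V), fcomposition_series l W.

Section Tensor.
Variable k : nat.

(* The free Q-vector space on the functions [k] -> [n]: the finite function a *)
(* stands for the formal sum of the a g [g].                                  *)
Definition tensor_obj (n : nat) : vectType rat := {ffun fmor k n -> rat^o}.

Definition tensor_fun m n (f : fmor m n) (a : tensor_obj m) : tensor_obj n :=
  [ffun h => \sum_(g : fmor k m | fcomp f g == h) a g].

Lemma tensor_fun_is_linear m n (f : fmor m n) : linear (tensor_fun f).
Proof.
move=> c a b; apply/ffunP => h; rewrite !ffunE scaler_sumr -big_split /=.
by apply: eq_bigr => g _; rewrite !ffunE.
Qed.

HB.instance Definition _ m n (f : fmor m n) :=
  GRing.isLinear.Build rat (tensor_obj m) (tensor_obj n) _ (tensor_fun f)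
    (tensor_fun_is_linear f).

Definition tensor_map m n (f : fmor m n) : 'Hom(tensor_obj m, tensor_obj n) :=
  linfun (tensor_fun f).

Lemma tensor_map_id n : tensor_map (fid n) = \1%VF.
Proof.
apply/lfunP => a; rewrite !lfunE /=; apply/ffunP => h; rewrite ffunE.
rewrite (big_pred1 h) // => g; congr (_ == h).
by apply/ffunP => x; rewrite !ffunE.
Qed.

Lemma tensor_map_comp m n p (g : fmor n p) (f : fmor m n) :
  tensor_map (fcomp g f) = (tensor_map g \o tensor_map f)%VF.
Proof.
apply/lfunP => a; rewrite comp_lfunE !lfunE /=; apply/ffunP => h.
rewrite !ffunE (partition_big (fcomp f) (fun u => fcomp g u == h)) /=; last first.
  move=> u /eqP<-; apply/eqP/ffunP => x; by rewrite !ffunE.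
apply: eq_bigr => u /eqP gu; rewrite ffunE; apply: eq_bigl => v.
case: (fcomp f v =P u) => [fv|]; rewrite ?andbF // andbT -gu -fv.
by apply/eqP/ffunP => x; rewrite !ffunE.
Qed.

Definition tensor : frep := FRep tensor_map_id tensor_map_comp.

End Tensor.

Definition zero_obj (n : nat) : vectType rat := 'rV[rat]_0.
Definition zero_map m n (f : fmor m n) : 'Hom(zero_obj m, zero_obj n) := 0.

Lemma zero_map_id n : zero_map (fid n) = \1%VF.
Proof. by apply/lfunP => x; rewrite [LHS]thinmx0 [RHS]thinmx0. Qed.

Lemma zero_map_comp m n p (g : fmor n p) (f : fmor m n) :
  zero_map (fcomp g f) = (zero_map g \o zero_map f)%VF.
Proof. by apply/lfunP => x; rewrite [LHS]thinmx0 [RHS]thinmx0. Qed.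

Definition zero_rep : frep := FRep zero_map_id zero_map_comp.

Section DirectSum.
Variables V W : frep.

Definition dsum_obj (n : nat) : vectType rat := (V n * W n)%type.

Definition dsum_fun m n (f : fmor m n) (x : dsum_obj m) : dsum_obj n :=
  (fmap V f x.1, fmap W f x.2).

Lemma dsum_fun_is_linear m n (f : fmor m n) : linear (dsum_fun f).
Proof. by move=> c x y; rewrite /dsum_fun /= !linearP. Qed.

HB.instance Definition _ m n (f : fmor m n) :=
  GRing.isLinear.Build rat (dsum_obj m) (dsum_obj n) _ (dsum_fun f)
    (dsum_fun_is_linear f).

Definition dsum_map m n (f : fmor m n) : 'Hom(dsum_obj m, dsum_obj n) :=
  linfun (dsum_fun f).

Lemma dsum_map_id n : dsum_map (fid n) = \1%VF.
Proof.
by apply/lfunP => -[x y]; rewrite !lfunE /= /dsum_fun !fmap_id !lfunE.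
Qed.

Lemma dsum_map_comp m n p (g : fmor n p) (f : fmor m n) :
  dsum_map (fcomp g f) = (dsum_map g \o dsum_map f)%VF.
Proof.
apply/lfunP => -[x y]; rewrite comp_lfunE !lfunE /= /dsum_fun /=.
by rewrite !fmap_comp !comp_lfunE.
Qed.

Definition dsum : frep := FRep dsum_map_id dsum_map_comp.

End DirectSum.

Definition tensor_sum (ks : seq nat) : frep :=
  foldr (fun k V => dsum (tensor k) V) zero_rep ks.

Definition finitely_generated (V : frep) : Prop :=
  exists (ks : seq nat) (q : fhom (tensor_sum ks) V), fsurj q.

(* Main.v *)
From HB Require Import structures.
Require Import Defs.
From mathcomp Require Import all_boot all_order all_algebra.
From Stdlib Require Import Classical.

(** Let e_i : [n+1] -> [n+1] send the point i to the base point 0 and fix every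
    other point, for i <> 0.  The e_i commute, and on the free vector space on
    the functions [k] -> [n+1] the product of the operators 1 - e_i vanishes as
    soon as k < n: a function g : [k] -> [n+1] misses some i <> 0, so e_i g = g,
    and the factor 1 - e_i may be applied first ([tensor_diff_vanish]).  This
    vanishing passes to direct sums and quotients, so a finitely generated V has
    it in every large degree ([finitely_generated_diff_vanish]).

    Expanding the product writes the identity of V[n+1] as a combination of
    noninjective maps, which factor through [n].  So a subfunctor of V is
    determined in large degrees by the lower ones, and two nested subfunctors
    that agree up to some degree N agree everywhere ([fsub_low_degrees]).
    The sum of the dimensions of W[0], ..., W[N] therefore increases strictly
    along strict inclusions of subfunctors W of V.  This bounds all chains,
    and a composition series is found by taking maximal proper subfunctors
    repeatedly ([ex_composition_series]).

    Conversely, if W2 / W1 is simple, generators of W1 together with one element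
    of W2 outside W1 generate W2 ([generated_extension]).  A functor of finite
    length is thus generated by finitely many elements, and by the Yoneda
    lemma an element of V[k] is the same as a morphism from the k-th tensor
    functor to V ([generated_finitely_generated]). *)

Set Implicit Arguments.
Unset Strict Implicit.
Unset Printing Implicit Defensive.

Import GRing.Theory.
Local Open Scope ring_scope.

(** * Subfunctors and quotient functors *)

Lemma eq_fullv (vT : vectType rat) (U : {vspace vT}) :
  (forall x, x \in U) -> U = fullv.
Proof. by move=> Ux; apply/vspaceP => x; rewrite Ux memvf. Qed.

Lemma fmap_fcomp (V : frep) m n p (g : fmor n p) (f : fmor m n) (x : V m) :
  fmap V (fcomp g f) x = fmap V g (fmap V f x).
Proof. by rewrite fmap_comp comp_lfunE. Qed.

Lemma fmap_fsub (V : frep) (U : fsub V) m n (f : fmor m n) (x : V m) :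
  x \in U m -> fmap V f x \in U n.
Proof. by move=> Ux; apply: (subvP (fsub_stable U f)); apply: memv_img. Qed.

Section Images.
Variables (V W : frep) (q : fhom V W).

Lemma fhom_nat m n (f : fmor m n) (x : V m) :
  q n (fmap V f x) = fmap W f (q m x).
Proof. by rewrite -!comp_lfunE fcpt_nat. Qed.

Lemma fpreim_stable (U : fsub W) m n (f : fmor m n) :
  (fmap V f @: (q m @^-1: U m) <= q n @^-1: U n)%VS.
Proof.
apply/subvP => _ /memv_imgP[x Ux ->].
by rewrite -memv_preim fhom_nat fmap_fsub // memv_preim.
Qed.
Definition fpreim (U : fsub W) : fsub V := FSub (fpreim_stable U).

Lemma fimg_stable (U : fsub V) m n (f : fmor m n) :
  (fmap W f @: (q m @: U m) <= q n @: U n)%VS.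
Proof.
apply/subvP => _ /memv_imgP[_ /memv_imgP[x Ux ->] ->].
by rewrite -fhom_nat memv_img // fmap_fsub.
Qed.
Definition fimg (U : fsub V) : fsub W := FSub (fimg_stable U).

Lemma fsurjP : fsurj q -> forall n (y : W n), exists x, y = q n x.
Proof.
move=> qs n y; have /memv_imgP[x _ ->]: y \in limg (q n) by rewrite qs memvf.
by exists x.
Qed.

End Images.

Lemma fsub0_stable (V : frep) m n (f : fmor m n) :
  (fmap V f @: (0%VS : {vspace V m}) <= (0%VS : {vspace V n}))%VS.
Proof. by rewrite limg0. Qed.
Definition fsub0 (V : frep) : fsub V := FSub (@fsub0_stable V).

Lemma fsubT_stable (V : frep) m n (f : fmor m n) :
  (fmap V f @: (fullv : {vspace V m}) <= (fullv : {vspace V n}))%VS.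
Proof. exact: subvf. Qed.
Definition fsubT (V : frep) : fsub V := FSub (@fsubT_stable V).

Section Inclusion.
Variables (V : frep) (W : fsub V).

Lemma fincl_nat m n (f : fmor m n) :
  (linfun (@vsval _ _ (W n)) \o fmap (fsub_rep W) f
   = fmap V f \o linfun (@vsval _ _ (W m)))%VF.
Proof.
apply/lfunP => x.
by rewrite comp_lfunE [RHS]comp_lfunE lfunE [in RHS]lfunE /= fsub_mapE.
Qed.

Definition fincl : fhom (fsub_rep W) V :=
  @FHom (fsub_rep W) V (fun n => linfun (@vsval _ _ (W n))) fincl_nat.

Lemma finclE n (x : fsub_rep W n) : fincl n x = vsval x.
Proof. by rewrite lfunE. Qed.

End Inclusion.

Section Quotient.
Variables (V : frep) (U : fsub V).

(** An idempotent with kernel U n: its image is a complement of U n, which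
    serves as a concrete model of the quotient V n / U n. *)
Definition fquo_proj n : 'End(V n) := (\1 - projv (U n))%VF.

Lemma fquo_projE n (x : V n) : fquo_proj n x = x - projv (U n) x.
Proof. by rewrite /fquo_proj !lfunE /= !lfunE. Qed.

Lemma fquo_proj_eq0 n (x : V n) : fquo_proj n x = 0 <-> x \in U n.
Proof.
rewrite fquo_projE; split=> [/eqP | /projv_id ->]; last by rewrite subrr.
by rewrite subr_eq0 => /eqP ->; apply: memv_proj.
Qed.

Definition fquo_obj n : vectType rat := subvs_of (limg (fquo_proj n)).

Definition fquo_cpt n : 'Hom(V n, fquo_obj n) :=
  (linfun (vsproj (limg (fquo_proj n))) \o fquo_proj n)%VF.

Lemma fquo_cptE n (x : V n) : vsval (fquo_cpt n x) = fquo_proj n x.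
Proof. by rewrite comp_lfunE lfunE /= vsprojK // memv_img ?memvf. Qed.

Lemma fquo_cpt_eq0 n (x : V n) : fquo_cpt n x = 0 <-> x \in U n.
Proof.
rewrite -fquo_proj_eq0 -fquo_cptE; split=> [->|x0]; first exact: linear0.
by apply: val_inj; rewrite /= x0.
Qed.

(** The inclusion of the complement is a section of the quotient map, because
    the idempotent fixes its own image. *)
Lemma fquo_cpt_val n (y : fquo_obj n) : fquo_cpt n (vsval y) = y.
Proof.
apply: val_inj; rewrite /= fquo_cptE.
have /memv_imgP[x _ ->] := subvsP y.
apply/eqP; rewrite -subr_eq0 -linearB /=; apply/eqP/fquo_proj_eq0.
by rewrite fquo_projE addrC addKr rpredN memv_proj.
Qed.

Definition fquo_map m n (f : fmor m n) : 'Hom(fquo_obj m, fquo_obj n) :=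
  (fquo_cpt n \o fmap V f \o linfun (@vsval _ _ (limg (fquo_proj m))))%VF.

Lemma fquo_map_val m n (f : fmor m n) (y : fquo_obj m) :
  fquo_map f y = fquo_cpt n (fmap V f (vsval y)).
Proof.
by rewrite /fquo_map; move: (fquo_cpt n) => c; rewrite 2!comp_lfunE lfunE.
Qed.

(** The complements are not stable under the functor, but V f applied to x and
    to the representative of x differ by an element of U n. *)
Lemma fquo_mapE m n (f : fmor m n) (x : V m) :
  fquo_map f (fquo_cpt m x) = fquo_cpt n (fmap V f x).
Proof.
rewrite fquo_map_val; apply/eqP.
rewrite -subr_eq0 -!linearB; apply/eqP/fquo_cpt_eq0.
apply: fmap_fsub; apply/fquo_cpt_eq0/eqP.
by rewrite (linearB (fquo_cpt m)) /= fquo_cpt_val subrr.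
Qed.

Lemma fquo_map_id n : fquo_map (fid n) = \1%VF.
Proof.
by apply/lfunP => y; rewrite -[y]fquo_cpt_val fquo_mapE fmap_id !lfunE.
Qed.

Lemma fquo_map_comp m n p (g : fmor n p) (f : fmor m n) :
  fquo_map (fcomp g f) = (fquo_map g \o fquo_map f)%VF.
Proof.
apply/lfunP => y.
by rewrite comp_lfunE -[y]fquo_cpt_val !fquo_mapE fmap_comp comp_lfunE.
Qed.

Definition fquo : frep := FRep fquo_map_id fquo_map_comp.

Lemma fquo_cpt_nat m n (f : fmor m n) :
  (fquo_cpt n \o fmap V f = fmap fquo f \o fquo_cpt m)%VF.
Proof.
by apply/lfunP => x; rewrite comp_lfunE [RHS]comp_lfunE /= fquo_mapE.
Qed.

Definition fquo_hom : fhom V fquo := @FHom V fquo fquo_cpt fquo_cpt_nat.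

Lemma fquo_surj : fsurj fquo_hom.
Proof.
move=> n; apply: eq_fullv => y.
by rewrite -[y]fquo_cpt_val memv_img ?memvf.
Qed.

End Quotient.

(** * The vanishing of the product of the differences 1 - e_i *)

Definition merge0 n (i : 'I_n.+1) : fmor n.+1 n.+1 :=
  [ffun x => if x == i then ord0 else x].

Lemma merge0C n (i j : 'I_n.+1) :
  fcomp (merge0 i) (merge0 j) = fcomp (merge0 j) (merge0 i).
Proof.
apply/ffunP => x; rewrite !ffunE.
by case xj: (x == j); case xi: (x == i); rewrite ?xj ?xi ?if_same.
Qed.

(** The map merging i = j + 1 into 0 misses i, so it factors through the
    enumeration of the complement of i. *)
Lemma merge0_factor n (j : 'I_n) :
  exists (d : fmor n n.+1) (p : fmor n.+1 n),
    merge0 (lift ord0 j) = fcomp d p.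
Proof.
set i := lift ord0 j.
(* The default value j is arbitrary: unlift succeeds as merge0 i x != i. *)
exists [ffun y => lift i y], [ffun x => odflt j (unlift i (merge0 i x))].
apply/ffunP => x; have: merge0 i x != i.
  by rewrite ffunE; case: ifP => [_ | ->]; first apply: neq_lift.
rewrite 3![in RHS]ffunE; case: unliftP => [y <- // | ->].
by rewrite eqxx.
Qed.

Section Difference.
Variables (V : frep) (n : nat).

Definition diffprod (s : seq 'I_n.+1) : 'End(V n.+1) :=
  foldr (fun i u => (\1 - fmap V (merge0 i)) \o u)%VF \1%VF s.

Lemma diffprod_cons i s v :
  diffprod (i :: s) v = diffprod s v - fmap V (merge0 i) (diffprod s v).
Proof. by rewrite /= comp_lfunE !lfunE /= !lfunE. Qed.

Lemma diffprodC i s v :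
  fmap V (merge0 i) (diffprod s v) = diffprod s (fmap V (merge0 i) v).
Proof.
elim: s => [|j s IHs]; first by rewrite !lfunE.
rewrite !diffprod_cons linearB /= -IHs; congr (_ - _).
by rewrite -!fmap_fcomp merge0C.
Qed.

(** As the factors commute, the one that kills v can be applied first. *)
Lemma diffprod_fixed i s v :
  i \in s -> fmap V (merge0 i) v = v -> diffprod s v = 0.
Proof.
move=> + iv; elim: s => // j s IHs.
rewrite in_cons diffprod_cons => /orP[/eqP <-|/IHs ->].
  by rewrite diffprodC iv subrr.
by rewrite linear0 subrr.
Qed.

(** If the merging maps send v into U, each factor 1 - e_i acts on the class of
    v modulo U as the identity. *)
Lemma diffprod_congr (U : fsub V) s v :
  {in s, forall i, fmap V (merge0 i) v \in U n.+1} ->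
  diffprod s v - v \in U n.+1.
Proof.
elim: s => [|i s IHs] Us; first by rewrite lfunE subrr mem0v.
have {}IHs: diffprod s v - v \in U n.+1.
  by apply: IHs => j js; apply: Us; rewrite in_cons js orbT.
rewrite diffprod_cons addrAC memvB // -[diffprod s v](subrK v) linearD /=.
by apply: memvD; [apply: fmap_fsub | apply/Us/mem_head].
Qed.

End Difference.

Lemma diffprod_nat (V W : frep) (q : fhom V W) n (s : seq 'I_n.+1) v :
  q n.+1 (diffprod V s v) = diffprod W s (q n.+1 v).
Proof.
elim: s => [|i s IHs]; first by rewrite !lfunE.
by rewrite !diffprod_cons linearB /= fhom_nat IHs.
Qed.

Definition nonzero_points n : seq 'I_n.+1 := [seq lift ord0 j | j : 'I_n].

Definition diff_vanish (V : frep) (n : nat) : Prop :=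
  forall v, diffprod V (nonzero_points n) v = 0.

Definition dirac k n (g : fmor k n) : tensor k n := [ffun h => (h == g)%:R].

Lemma tensor_sum_dirac k n (a : tensor k n) : a = \sum_g a g *: dirac g.
Proof.
apply/ffunP => h; rewrite sum_ffunE (bigD1 h) //= big1 ?addr0.
  by rewrite !ffunE eqxx [_ *: _]mulr1.
by move=> g /negPf; rewrite !ffunE eq_sym => ->; apply: mulr0.
Qed.

Lemma tensor_map_dirac k m n (f : fmor m n) (g : fmor k m) :
  fmap (tensor k) f (dirac g) = dirac (fcomp f g).
Proof.
rewrite /= lfunE; apply/ffunP => h; rewrite !ffunE (eq_sym h).
rewrite big_mkcond (bigD1 g) //= big1 => [|u /negPf ug].
  by rewrite addr0 ffunE eqxx; case: ifP.
by rewrite ffunE ug; case: ifP.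
Qed.

(** There are n nonzero points, and a function on k < n points misses one of
    them. *)
Lemma tensor_diff_vanish k n : (k < n)%N -> diff_vanish (tensor k) n.
Proof.
move=> kn v; rewrite (tensor_sum_dirac v) linear_sum big1 // => g _.
rewrite linearZ /=; suff [j jg]: exists j : 'I_n, lift ord0 j \notin codom g.
    have fixed: fmap (tensor k) (merge0 (lift ord0 j)) (dirac g) = dirac g.
    rewrite tensor_map_dirac; congr dirac; apply/ffunP => x; rewrite !ffunE.
    by case: eqP => // gx; rewrite -gx codom_f in jg.
  rewrite -[RHS](scaler0 _ (v g)); congr (_ *: _).
  by apply: diffprod_fixed fixed; apply: map_f; rewrite mem_enum.
apply/existsP; rewrite -negb_forall; apply/negP => /forallP all_g.
suff: (#|'I_n| <= #|codom g|)%N.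
  rewrite card_ord => /leq_trans/(_ (leq_image_card _ _)).
  by rewrite card_ord leqNgt kn.
rewrite -(card_codom (@lift_inj _ (@ord0 n))); apply/subset_leq_card/subsetP.
by move=> _ /codomP[j ->].
Qed.

Lemma dsum_diff_vanish V W n :
  diff_vanish V n -> diff_vanish W n -> diff_vanish (dsum V W) n.
Proof.
move=> V0 W0 [x y]; suff: forall s, diffprod (dsum V W) s (x, y)
    = (diffprod V s x, diffprod W s y) by move=> ->; rewrite V0 W0.
elim=> [|i s IHs]; first by rewrite !lfunE.
by rewrite !diffprod_cons IHs lfunE.
Qed.

Lemma tensor_sum_diff_vanish ks n :
  all (fun k => k < n)%N ks -> diff_vanish (tensor_sum ks) n.
Proof.
elim: ks => [_ v|k ks IHs /= /andP[kn /IHs ksn]]; first exact: thinmx0.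
by apply: dsum_diff_vanish; first apply: tensor_diff_vanish.
Qed.

Lemma quotient_diff_vanish V W (q : fhom V W) n :
  fsurj q -> diff_vanish V n -> diff_vanish W n.
Proof.
move=> /fsurjP qs V0 v; have [x ->] := qs _ v.
by rewrite -diffprod_nat V0 linear0.
Qed.

Lemma finitely_generated_diff_vanish V : finitely_generated V ->
  exists N, forall n, (N <= n)%N -> diff_vanish V n.
Proof.
case=> ks [q qs]; exists (\max_(k <- ks) k).+1 => n Nn.
apply: quotient_diff_vanish qs _; apply: tensor_sum_diff_vanish.
by apply/allP => k kks; apply: leq_trans Nn; rewrite ltnS leq_bigmax_seq.
Qed.

(** * Bounding chains of subfunctors *)

Section Chains.
Variables (V : frep) (N : nat).
Hypothesis V0 : forall n, (N <= n)%N -> diff_vanish V n.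

(** For w in W[n+1] with n at least N, every e_i w comes from W[n] = U[n], so w
    is congruent modulo U to the product of the 1 - e_i applied to w, which
    is zero. *)
Lemma fsub_low_degrees (U W : fsub V) :
  (forall n, U n <= W n)%VS -> (forall n, (n <= N)%N -> U n = W n) ->
  forall n, U n = W n.
Proof.
move=> UW low; elim=> [|n IHn]; first exact: low.
have [nN|Nn] := leqP n.+1 N; first exact: low.
apply/eqP; rewrite eqEsubv UW; apply/subvP => w Ww.
suff: diffprod V (nonzero_points n) w - w \in U n.+1.
  by rewrite V0 // sub0r rpredN.
apply: diffprod_congr => _ /mapP[j _ ->].
have [d [p ->]] := merge0_factor j.
by rewrite fmap_fcomp fmap_fsub // IHn fmap_fsub.
Qed.

(** A finite measure of subfunctors that detects strict inclusions, by the
    preceding lemma, and so bounds the length of every chain below W. *)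
Definition low_dim (W : fsub V) : nat := (\sum_(n < N.+1) \dim (W n))%N.

Lemma low_dim_mono (U W : fsub V) :
  (forall n, U n <= W n)%VS -> (low_dim U <= low_dim W)%N.
Proof. by move=> UW; apply: leq_sum => n _; apply: dimvS. Qed.

Lemma low_dim_eq (U W : fsub V) :
  (forall n, U n <= W n)%VS -> (low_dim W <= low_dim U)%N ->
  forall n, U n = W n.
Proof.
move=> UW le_dim; apply: fsub_low_degrees => // n nN.
have: (low_dim U <= low_dim W ?= iff [forall n : 'I_N.+1, U n == W n])%N.
  by apply: leqif_sum => i _; apply: dimv_leqif_eq.
move/geq_leqif; rewrite le_dim => /esym/forallP.
by move/(_ (Ordinal (nN : (n < N.+1)%N)))/eqP.
Qed.

Lemma ex_maximal_fsub (P : fsub V -> Prop) (U0 : fsub V) : P U0 ->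
  exists2 U, P U & forall T, P T -> (low_dim T <= low_dim U)%N.
Proof.
have [m] := ubnP (low_dim (fsubT V) - low_dim U0).
elim: m U0 => // m IHm U0 ltm PU0.
have [|notmax] := classic (forall T, P T -> (low_dim T <= low_dim U0)%N).
  by exists U0.
have [T notT] := not_all_ex_not _ _ notmax.
have [PT /negP] := imply_to_and _ _ notT; rewrite -ltnNge => ltT.
apply: (IHm T) => //.
apply: leq_trans (ltm : (_ <= m)%N); apply: ltn_sub2l => //.
by apply: leq_trans ltT _; apply: low_dim_mono => n; apply: subvf.
Qed.

(** Subfunctors of the quotient W / U correspond to subfunctors of V between U
    and W, so the quotient is simple when U is maximal among the proper
    subfunctors of W. *)
Lemma simple_subquotient (U W : fsub V) :
  (forall n, U n <= W n)%VS -> ~ (forall n, U n = W n) ->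
  (forall T : fsub V, (forall n, U n <= T n)%VS -> (forall n, T n <= W n)%VS ->
     ~ (forall n, T n = W n) -> forall n, U n = T n) ->
  exists S, fsimple S /\ fsubquotient U W S.
Proof.
move=> UW neUW max; pose U' := fpreim (fincl W) U.
pose q : fhom (fsub_rep W) (fquo U') := fquo_hom U'.
have q0 n (x : fsub_rep W n) : q n x = 0 <-> vsval x \in U n.
  by rewrite fquo_cpt_eq0 -memv_preim finclE.
exists (fquo U'); split; last first.
  by split=> //; exists q; split=> //; apply: fquo_surj.
split.
  have [n neUWn] := not_all_ex_not _ _ neUW; exists n.
  apply/negP => /eqP full0; apply: neUWn; apply/eqP; rewrite eqEsubv UW.
  apply/subvP => w Ww; rewrite -(vsprojK Ww); apply/q0/eqP.
  by rewrite -memv0 -full0 memvf.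
move=> Z; pose T := fimg (fincl W) (fpreim q Z).
have memT n (x : fsub_rep W n) : (vsval x \in T n) = (q n x \in Z n).
  apply/idP/idP => [/memv_imgP[y]|Zx]; last first.
    by rewrite -finclE memv_img // -memv_preim.
  by rewrite -memv_preim finclE => Zy /val_inj ->.
have TW n : (T n <= W n)%VS.
  by apply/subvP => _ /memv_imgP[x _ ->]; rewrite finclE subvsP.
have UT n : (U n <= T n)%VS.
  apply/subvP => u Uu; have Wu := subvP (UW n) u Uu.
  rewrite -(vsprojK Wu) memT (_ : q n _ = 0) ?mem0v //.
  by apply/q0; rewrite vsprojK.
have [eqTW|/(max T UT TW) eqUT] := classic (forall n, T n = W n); [right|left].
  move=> n; apply: eq_fullv => z.
  by have [x ->] := fsurjP (@fquo_surj _ _) z; rewrite -memT eqTW subvsP.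
move=> n; apply/eqP; rewrite -subv0; apply/subvP => z.
have [x ->] := fsurjP (@fquo_surj _ _) z; rewrite -memT -eqUT => /q0 ->.
exact: mem0v.
Qed.

(** By induction on the measure: a proper subfunctor U of W of maximal measure
    is maximal for inclusion, and W is put on top of a series for U. *)
Lemma ex_composition_series (W : fsub V) : exists l (C : nat -> fsub V),
  [/\ forall n, C 0%N n = 0%VS, forall n, C l n = W n &
      forall i, (i < l)%N ->
        exists S, fsimple S /\ fsubquotient (C i) (C i.+1) S].
Proof.
have [m] := ubnP (low_dim W); elim: m W => // m IHm W ltm.
have [W0|neW0] := classic (forall n, W n = 0%VS).
  by exists 0%N, (fun _ => fsub0 V); split=> //.
pose proper (U : fsub V) :=
  (forall n, U n <= W n)%VS /\ ~ (forall n, U n = W n).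
have [|U [UW neUW] maxU] := @ex_maximal_fsub proper (fsub0 V).
  by split=> [n|eq0]; [apply: sub0v | apply: neW0 => n; rewrite -eq0].
have ltU : (low_dim U < low_dim W)%N.
  by rewrite ltnNge; apply/negP => /(low_dim_eq UW).
have [l [C [C0 Cl Cs]]] := IHm U (leq_trans ltU (ltm : (_ <= m)%N)).
exists l.+1, (fun i => if (i <= l)%N then C i else W); split=> //.
  by rewrite ltnn.
move=> i; rewrite ltnS => /=; have [il _|//|-> _] := ltngtP i l.
  exact: Cs.
have [|S [simS [_ [q [qs qk]]]]] := simple_subquotient UW neUW.
  by move=> T UT TW neTW; apply: low_dim_eq => //; apply: maxU.
exists S; split=> //; split=> [n|]; first by rewrite Cl.
by exists q; split=> // n x; rewrite Cl; apply: qk.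
Qed.

End Chains.

(** * Generators *)

Section Yoneda.
Variables (V : frep) (k : nat) (v : V k).

(** The component at n of the morphism that the Yoneda lemma attaches to v. *)
Definition yoneda_fun n (a : tensor k n) : V n := \sum_g a g *: fmap V g v.

Lemma yoneda_is_linear n : linear (@yoneda_fun n).
Proof.
move=> c a b; rewrite /yoneda_fun scaler_sumr -big_split /=.
by apply: eq_bigr => g _; rewrite !ffunE scalerDl scalerA.
Qed.
HB.instance Definition _ n :=
  GRing.isLinear.Build rat (tensor k n) (V n) _ (@yoneda_fun n)
    (@yoneda_is_linear n).

Lemma yoneda_dirac n (h : fmor k n) : yoneda_fun (dirac h) = fmap V h v.
Proof.
rewrite /yoneda_fun (bigD1 h) //= big1 => [|u /negPf uh]; rewrite ffunE.
  by rewrite eqxx scale1r addr0.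
by rewrite uh scale0r.
Qed.

Lemma yoneda_nat m n (f : fmor m n) :
  (linfun (@yoneda_fun n) \o fmap (tensor k) f
   = fmap V f \o linfun (@yoneda_fun m))%VF.
Proof.
apply/lfunP => a; rewrite [a]tensor_sum_dirac !linear_sum.
apply: eq_bigr => g _; rewrite !linearZ /=; congr (_ *: _).
rewrite comp_lfunE [RHS]comp_lfunE tensor_map_dirac lfunE [in RHS]lfunE /=.
by rewrite !yoneda_dirac fmap_fcomp.
Qed.

Definition yoneda : fhom (tensor k) V :=
  @FHom (tensor k) V (fun n => linfun (@yoneda_fun n)) yoneda_nat.

Lemma yoneda_hit : v \in limg (yoneda k).
Proof.
apply/memv_imgP; exists (dirac (fid k)); first exact: memvf.
by rewrite lfunE /= yoneda_dirac fmap_id lfunE.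
Qed.

End Yoneda.

Section Copairing.
Variables (A B V : frep) (q : fhom A V) (r : fhom B V).

Definition copair_fun n (x : dsum A B n) : V n := q n x.1 + r n x.2.

Lemma copair_is_linear n : linear (@copair_fun n).
Proof.
by move=> c x y; rewrite /copair_fun !linearP /= scalerDr addrACA.
Qed.
HB.instance Definition _ n :=
  GRing.isLinear.Build rat (dsum A B n) (V n) _ (@copair_fun n)
    (@copair_is_linear n).

Lemma copair_nat m n (f : fmor m n) :
  (linfun (@copair_fun n) \o fmap (dsum A B) f
   = fmap V f \o linfun (@copair_fun m))%VF.
Proof.
apply/lfunP => x; rewrite !comp_lfunE !lfunE /= /copair_fun /=.
by rewrite linearD /= !fhom_nat.
Qed.

Definition copair : fhom (dsum A B) V :=
  @FHom (dsum A B) V (fun n => linfun (@copair_fun n)) copair_nat.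

Lemma limg_copair n : (limg (q n) + limg (r n) <= limg (copair n))%VS.
Proof.
rewrite subv_add; apply/andP; split; apply/subvP => _ /memv_imgP[x _ ->];
  apply/memv_imgP; [exists (x, 0) | exists (0, x)];
  by rewrite ?memvf // lfunE /= /copair_fun /= linear0 ?addr0 ?add0r.
Qed.

End Copairing.

Lemma fhom0_nat (A B : frep) m n (f : fmor m n) :
  ((0 : 'Hom(A n, B n)) \o fmap A f = fmap B f \o (0 : 'Hom(A m, B m)))%VF.
Proof. by rewrite comp_lfun0l comp_lfun0r. Qed.
Definition fhom0 (A B : frep) : fhom A B := FHom (@fhom0_nat A B).

Definition contains (V : frep) (s : seq {n & V n}) (U : fsub V) : bool :=
  all (fun x => tagged x \in U (tag x)) s.

Definition generated_by (V : frep) (s : seq {n & V n}) (W : fsub V) : Prop :=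
  forall U, contains s U -> forall n, (W n <= U n)%VS.

(** The image of a morphism is a subfunctor, so hitting a set of generators is
    enough for surjectivity. *)
Lemma ex_hom_hitting (V : frep) (s : seq {n & V n}) :
  exists (ks : seq nat) (q : fhom (tensor_sum ks) V),
    contains s (fimg q (fsubT _)).
Proof.
elim: s => [|[k v] s [ks [q qs]]]; first by exists [::], (fhom0 _ _).
exists (k :: ks), (copair (yoneda v) q); apply/andP; split=> /=.
  apply: (subvP (limg_copair _ _ _)); apply: (subvP (addvSl _ _)).
  exact: yoneda_hit.
apply: sub_all qs => x xq.
by apply: (subvP (limg_copair _ _ _)); apply: (subvP (addvSr _ _)).
Qed.

Lemma generated_finitely_generated (V : frep) (s : seq {n & V n}) :
  generated_by s (fsubT V) -> finitely_generated V.
Proof.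
move=> gen; have [ks [q qs]] := ex_hom_hitting s; exists ks, q => n.
by apply: eq_fullv => v; apply: (subvP (gen _ qs n)); apply: memvf.
Qed.

(** If x in W2 maps to a nonzero element of S = W2 / W1 and U contains W1 and x,
    then the image of U in S is nonzero, hence all of S; so an element of W2
    differs from one of U by an element of W1. *)
Lemma generated_extension (V : frep) (W1 W2 : fsub V) S s :
  fsimple S -> fsubquotient W1 W2 S -> generated_by s W1 ->
  exists t, generated_by t W2.
Proof.
move=> [[n S0] simS] [_ [q [/fsurjP qs qk]]] gen.
have [x qx0]: exists x, q n x != 0.
  have := S0; rewrite -vpick0.
  have [x ->] := qs _ (vpick (fullv : {vspace S n})).
  by exists x.
exists (existT _ n (vsval x) :: s) => U /= /andP[/= Ux /gen W1U].
pose Z := fimg q (fpreim (fincl W2) U).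
have Zx : q n x \in Z n.
  by rewrite memv_img // -memv_preim finclE.
have ZT : forall p, Z p = fullv.
  have [Z0|//] := simS Z.
  by rewrite Z0 memv0 (negPf qx0) in Zx.
move=> p; apply/subvP => w Ww.
have: q p (vsproj (W2 p) w) \in Z p by rewrite ZT memvf.
case/memv_imgP => u; rewrite -memv_preim finclE => Uu /eqP.
rewrite -subr_eq0 -linearB => /eqP/qk; rewrite linearB /= vsprojK // => W1d.
by rewrite -(subrK (vsval u) w) memvD // (subvP (W1U p)).
Qed.

Theorem theorem5p3 (V : frep) : finitely_generated V <-> finite_length V.
Proof.
split=> [/finitely_generated_diff_vanish[N V0]|[l [W [W0 Wl Ws]]]].
  by have [l [C CW]] := ex_composition_series V0 (fsubT V); exists l, C.
suff [s gen]: exists s, generated_by s (W l).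
  apply: (@generated_finitely_generated _ s) => U /gen WU n.
  by rewrite /= -Wl.
have: (l <= l)%N by [].
elim: {-2}l => [|i IHi] il.
  by exists [::] => U _ n; rewrite W0 sub0v.
have [s gen] := IHi (ltnW il); have [S [simS sub]] := Ws i il.
exact: generated_extension simS sub gen.
Qed.
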